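(* For every integer $n \geqslant 7$ there exists a family $\mathcal{F}$ of $n$ non-vertical, pairwise non-parallel lines in the plane $\mathbb{R}^2$, which are not concurrent (that is, $\bigcap \mathcal{F} = \emptyset$), such that no vertical line $L$ contains exactly $n-1$ or exactly $n-2$ points of $\bigcup \mathcal{F}$; that is, for every vertical line $L$, $|L \cap \bigcup \mathcal{F}| \notin \{n-1, n-2\}$.
   Context: A vertical line in $\mathbb{R}^2$ is a set of the form $\{(x,y) \in \mathbb{R}^2 : x = a\}$ for some $a \in \mathbb{R}$; a line is non-vertical if it is not of this form. The $n$ lines of the family are pairwise distinct. Here $\bigcup \mathcal{F} \subseteq \mathbb{R}^2$ is the union of the lines in $\mathcal{F}$ as point sets, and $\bigcap \mathcal{F}$ is the set of points common to all lines in $\mathcal{F}$. *)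

(* Defs.v *)
From HB Require Import structures.
From mathcomp Require Import all_boot all_order all_algebra.
From mathcomp Require Import mathcomp_extra boolp classical_sets functions.
From mathcomp Require Import cardinality reals.

Set Implicit Arguments.
Unset Strict Implicit.
Unset Printing Implicit Defensive.

Import Order.TTheory GRing.Theory Num.Theory.

Local Open Scope classical_set_scope.
Local Open Scope ring_scope.

Definition is_line (R : realType) (l : set (R * R)) : Prop :=
  exists a b c : R, (a, b) <> (0, 0) /\
    l = [set p | a * p.1 + b * p.2 = c].

Definition is_vertical (R : realType) (l : set (R * R)) : Prop :=
  exists a : R, l = [set p | p.1 = a].

(* Meant for lines; with this convention every line is parallel to itself. *)
Definition parallel (R : realType) (l m : set (R * R)) : Prop :=
  l = m \/ l `&` m = set0.

(* Main.v *)
Require Import Defs.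
From HB Require Import structures.
From mathcomp Require Import all_boot all_order all_algebra.
From mathcomp Require Import mathcomp_extra boolp classical_sets functions.
From mathcomp Require Import cardinality reals.
From mathcomp Require Import trigo zify ring lra.

Set Implicit Arguments.
Unset Strict Implicit.
Unset Printing Implicit Defensive.

Import Order.TTheory GRing.Theory Num.Theory.

Local Open Scope classical_set_scope.
Local Open Scope card_scope.
Local Open Scope ring_scope.

(** Dualizing the line y = c x + s to the point (c, s), the points of the union
    on the vertical line x = a correspond to the classes of dual points under
    projection along a fixed direction.  The dual points are taken to be the
    vertices of a regular n-gon, turned so that no chord is vertical.  The chord
    through vertices i and j has a direction that depends only on i + j modulo n,
    so as soon as one pair of vertices is identified, the whole reflection
    k |-> i + j - k of Z/n is; it fixes at most two vertices, hence for n >= 7 it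
    identifies at least three pairs and at most n - 3 classes remain. *)

(** * Orbits of a reflection of Z/n *)

Lemma card_reflection_image_le (T : Type) (g : nat -> T) (n s : nat) :
  (7 <= n)%N -> (s < n)%N ->
  (forall k l, (k < n)%N -> (l < n)%N ->
    (k + l = s \/ k + l = s + n)%N -> g k = g l) ->
  g @` `I_n #<= `I_(n - 3).
Proof.
move=> n7 sn gE.
have rlt (k : 'I_n) : ((if k <= s then s - k else s + n - k) < n)%N.
  by have := ltn_ord k; case: ifP; lia.
pose r (k : 'I_n) := Ordinal (rlt k).
have rv k : r k = (if k <= s then s - k else s + n - k)%N :> nat by [].
have rK : involutive r.
  move=> k; apply: ord_inj; rewrite !rv.
  by have := ltn_ord k; case: (leqP k s) => ?; case: ifP; lia.
have rg k : g (r k) = g k.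
  apply: gE; [exact: ltn_ord|exact: ltn_ord|rewrite rv].
  by have := ltn_ord k; case: ifP; lia.
(* [D] holds the smaller index of each two-element orbit of [r]; dropping [D] does not change the
   image of [g]. *)
pose D := [set k : 'I_n | (k < r k)%N]%SET; pose D' := [set k : 'I_n | (r k < k)%N]%SET.
pose Fx := [set k : 'I_n | r k == k]%SET.
have cDD' : #|D'| = #|D|.
  rewrite -(card_imset (mem D) (inv_inj rK)); apply: eq_card => k.
  apply/idP/imsetP => [|[l]]; last by rewrite !finset.inE => ? ->; rewrite rK.
  by rewrite finset.inE => kD; exists (r k); rewrite ?finset.inE rK.
have cF : (#|Fx| <= 2)%N.
  have n0 : (0 < n)%N by lia.
  (* A fixed index satisfies 2k = s or 2k = s + n, so it is one of the two halves; [h] only recasts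
     these as ordinals. *)
  pose h m : 'I_n := insubd (Ordinal n0) m.
  apply: leq_trans (subset_leq_card (B := [set h s./2; h (s + n)./2]%SET) _) _.
    apply/fintype.subsetP => k; rewrite !finset.inE -!val_eqE /= => /eqP rk.
    have kn := ltn_ord k.
    suff [e|e] : k = s./2 :> nat \/ k = ((s + n)./2)%N :> nat.
    - by rewrite val_insubd -e kn eqxx.
    - by rewrite !val_insubd -e kn eqxx orbT.
    by move: rk; case: ifP; lia.
  by rewrite cards2; case: (_ != _).
have cover : (#|(~: D)%SET| <= n - 3)%N.
  have sub : (~: D \subset D' :|: Fx)%SET.
    apply/fintype.subsetP => k; rewrite !finset.inE -val_eqE /= -leqNgt leq_eqVlt.
    by rewrite orbC.
  (* From |~D| <= |D| + 2 and |D| + |~D| = n follows 2|D| >= n - 2 >= 5, hence |D| >= 3. *)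
  have := subset_leq_card sub; have := (leq_card_setU D' Fx).1.
  by have := cardsC D; rewrite card_ord; lia.
pose e := [seq val k | k <- enum (~: D)%SET].
apply: (@card_le_trans _ _ _ `I_(size e)); last first.
  by rewrite card_le_II size_map -cardE.
suff sub : g @` `I_n `<=` (fun i => g (nth 0%N e i)) @` `I_(size e).
  exact: card_le_trans (subset_card_le sub) (card_image_le _ _).
move=> _ [k kn <-].
suff [l lD <-] : exists2 l : 'I_n, l \notin D & g l = g k.
  have le : val l \in e by rewrite map_f // mem_enum finset.inE.
  by exists (index (val l) e); rewrite /= ?index_mem ?nth_index.
pose k' : 'I_n := Ordinal kn.
case: (boolP (k' \in D)) => [kD|]; last by exists k'.
by exists (r k'); rewrite ?rg // finset.inE rK -leqNgt ltnW //; rewrite finset.inE in kD.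
Qed.

(** * Trigonometry of the regular polygon *)

Section RegularPolygon.
Variables (R : realType) (n : nat).
Hypothesis n_gt0 : (0 < n)%N.
Implicit Types (x t d : R) (i j k s : nat).

(* The vertices sit at the even angles [angle (2 * k)]; the chord through
   vertices i and j is then normal to the direction [angle (i + j)]. *)
Definition angle s : R := (2 * s%:R + 1) * pi / (2 * n%:R).

(** The value at x of the line dual to the point (cos t, sin t) of the unit circle. *)
Definition height x t : R := x * cos t + sin t.

Let n_neq0 : n%:R != 0 :> R.
Proof. by rewrite pnatr_eq0 -lt0n. Qed.

Let n_gt0R : 0 < n%:R :> R.
Proof. by rewrite ltr0n. Qed.

Lemma heightDB x t d :
  height x (t + d) - height x (t - d) = 2 * sin d * (cos t - x * sin t).
Proof. by rewrite /height cosD sinD cosB sinB; ring. Qed.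

Lemma angleDn s : angle (s + n) = angle s + pi.
Proof. by rewrite /angle natrD; field. Qed.

Lemma sin_fraction_pi_neq0 i j : (i < j < i + n)%N ->
  sin ((j%:R - i%:R) * pi / n%:R : R) != 0.
Proof.
move=> /andP[ij jn]; rewrite gt_eqF // sin_gt0_pi //.
have ij' : (i%:R < j%:R :> R) by rewrite ltr_nat.
have jn' : (j%:R < i%:R + n%:R :> R) by rewrite -natrD ltr_nat.
have := pi_gt0 R => pi0; rewrite divr_gt0 ?mulr_gt0 ?subr_gt0 //=.
by rewrite ltr_pdivrMr // mulrC ltr_pM2l //; lra.
Qed.

(** The offset pi / (2n) in [angle] keeps it strictly between 0 and pi for s < n, and adding n to s
    adds pi. Hence no chord is vertical. *)
Lemma sin_angle_neq0 s : (s < 2 * n)%N -> sin (angle s) != 0.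
Proof.
have small m : (m < n)%N -> sin (angle m) != 0.
  move=> mn; rewrite gt_eqF // sin_gt0_pi //.
  have m0 : 0 <= m%:R :> R by [].
  have mn' : (m%:R + 1 <= n%:R :> R) by rewrite natr1 ler_nat.
  have := pi_gt0 R => pi0; apply/andP; split.
    by rewrite divr_gt0 ?mulr_gt0 //; lra.
  by rewrite ltr_pdivrMr ?mulr_gt0 // mulrC ltr_pM2l //; lra.
case: (ltnP s n) => [/small //|ns s2n].
by rewrite -(subnK ns) angleDn sinDpi oppr_eq0 small //; lia.
Qed.

(** Says that x is the cotangent of [angle s], the abscissa where dual lines i and j with i + j = s
    cross. *)
Definition balanced x s := cos (angle s) = x * sin (angle s).

Lemma balancedDn x s : balanced x (s + n) <-> balanced x s.
Proof.
rewrite /balanced angleDn cosDpi sinDpi mulrN.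
by split=> [/oppr_inj|->].
Qed.

(** The angles of vertices i and j are [angle (i + j)] minus and plus (j - i) pi / n; the last
    factor sees only i + j. *)
Lemma heightB x i j : height x (angle (2 * j)) - height x (angle (2 * i)) =
  2 * sin ((j%:R - i%:R) * pi / n%:R) *
  (cos (angle (i + j)) - x * sin (angle (i + j))).
Proof.
rewrite -heightDB /angle !natrM natrD.
by congr (height x _ - height x _); field.
Qed.

Lemma balanced_height x i j :
  balanced x (i + j) -> height x (angle (2 * i)) = height x (angle (2 * j)).
Proof.
move=> e; apply/esym/eqP; rewrite -subr_eq0 heightB.
by rewrite e subrr mulr0.
Qed.

Lemma height_balanced x i j : (i < n)%N -> (j < n)%N -> i <> j ->
  height x (angle (2 * i)) = height x (angle (2 * j)) -> balanced x (i + j).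
Proof.
wlog ij : i j / (i < j)%N.
  move=> wl ni nj; case: (ltngtP i j) => // ij neq e; first by apply: wl.
  by rewrite addnC; apply: wl => //; lia.
move=> _ nj _ /esym/eqP; rewrite -subr_eq0 heightB mulf_eq0 mulf_eq0 pnatr_eq0.
rewrite (negbTE (sin_fraction_pi_neq0 _)) /= ?subr_eq0; last by lia.
by move/eqP.
Qed.

(** * The family of dual lines *)

Definition dual_line k : set (R * R) :=
  [set p | p.2 = height p.1 (angle (2 * k))].

Lemma is_line_dual_line k : is_line (dual_line k).
Proof.
exists (- cos (angle (2 * k))), 1, (sin (angle (2 * k))); split.
  by case=> _ /eqP; rewrite oner_eq0.
by apply/seteqP; split=> -[x y]; rewrite /dual_line /height /= => h; lra.
Qed.

Lemma not_vertical_dual_line k : ~ is_vertical (dual_line k).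
Proof.
case=> a e.
have m x : x = a.
  have : dual_line k (x, height x (angle (2 * k))) by [].
  by rewrite e.
by have /eqP := m 0; rewrite -(m 1) eq_sym oner_eq0.
Qed.

Lemma dual_line_meet i j : (i < n)%N -> (j < n)%N ->
  dual_line i `&` dual_line j !=set0.
Proof.
move=> ni nj; pose x := cos (angle (i + j)) / sin (angle (i + j)).
exists (x, height x (angle (2 * i))); split => //=.
apply: balanced_height; rewrite /balanced divfK // sin_angle_neq0 //; lia.
Qed.

(** At a common point the chords 01 and 02 would have the same direction, yet their normals differ
    by the angle pi / n. *)
Lemma dual_lines_not_concurrent x : (3 <= n)%N ->
  ~ (forall i j, (i < n)%N -> (j < n)%N ->
     height x (angle (2 * i)) = height x (angle (2 * j))).
Proof.
move=> n3 h.
have b1 : balanced x (0 + 1) by apply: height_balanced; [lia|lia|lia|apply: h; lia].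
have b2 : balanced x (0 + 2) by apply: height_balanced; [lia|lia|lia|apply: h; lia].
have : sin (angle 2 - angle 1) = 0.
  by move: b1 b2; rewrite /balanced sinB !add0n => -> ->; ring.
suff -> : angle 2 - angle 1 = (2%:R - 1%:R) * pi / n%:R.
  by apply/eqP; apply: sin_fraction_pi_neq0; lia.
by rewrite /angle; field.
Qed.

Lemma dual_line_inj : (3 <= n)%N -> {in `I_n &, injective dual_line}.
Proof.
move=> n3 i j; rewrite !inE /= => ni nj e; apply: contrapT => ij.
have b x : balanced x (i + j).
  apply: height_balanced => //.
  have : dual_line i (x, height x (angle (2 * i))) by [].
  by rewrite e.
(* At x = 0 the cosine vanishes, and at x = 1 it equals the sine. *)
have s0 : sin (angle (i + j)) = 0.
  by have := b 0; have := b 1; rewrite /balanced => ->; lra.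
by have := @sin_angle_neq0 (i + j); rewrite s0 eqxx => /(_ _)/negP; case; lia.
Qed.

Lemma card_heights x m : (7 <= n)%N ->
  (fun k => height x (angle (2 * k))) @` `I_n #= `I_m ->
  m = n \/ (m <= n - 3)%N.
Proof.
move=> n7 cm; set g := (X in X @` _) in cm.
have [inj|] := pselect ({in `I_n &, injective g}).
  left; apply/card_eq_II; rewrite -(card_eqr (inj_card_eq inj)).
  by rewrite card_eq_sym.
move=> ninj; right; rewrite -card_le_II -(card_le_eql cm).
have [i [j [ni nj ij gij]]] :
    exists i j, [/\ (i < n)%N, (j < n)%N, i <> j & g i = g j].
  apply: contrapT => none; apply: ninj => i j; rewrite !inE /= => ni nj gij.
  by apply: contrapT => ij; apply: none; exists i, j.
(* One coincidence makes x balanced for i + j; reduced modulo n, this sum gives all coincidences of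
   the reflection k |-> s - k. *)
have b := height_balanced ni nj ij gij.
pose s := (if i + j < n then i + j else i + j - n)%N.
have bs : balanced x s.
  by rewrite /s; case: ltnP => // le; apply/balancedDn; rewrite subnK.
apply: (@card_reflection_image_le _ _ _ s) => //.
  by rewrite /s; case: (ltnP (i + j) n); lia.
move=> k l _ _ [e|e]; apply: balanced_height; rewrite e //.
exact/balancedDn.
Qed.

End RegularPolygon.

Theorem mainTheorem1 (R : realType) (n : nat) (hn : (7 <= n)%N) :
  exists F : set (set (R * R)),
    F #= `I_n /\
    (forall l, F l -> is_line l /\ ~ is_vertical l) /\
    (forall l m, F l -> F m -> l <> m -> ~ parallel l m) /\
    \bigcap_(l in F) l = set0 /\
    (forall L : set (R * R), is_vertical L ->
       ~ ((L `&` \bigcup_(l in F) l) #= `I_(n - 1)%N) /\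
       ~ ((L `&` \bigcup_(l in F) l) #= `I_(n - 2)%N)).
Proof.
have n0 : (0 < n)%N by lia.
have n3 : (3 <= n)%N by lia.
exists (@dual_line R n @` `I_n); split; first exact: inj_card_eq (dual_line_inj n0 n3).
split=> [_ [k _ <-]|].
  by split; [exact: is_line_dual_line|exact: not_vertical_dual_line].
split=> [_ _ [i ni <-] [j nj <-] ne [//|e]|].
  by have [p] := dual_line_meet R n0 ni nj; rewrite e.
split.
  rewrite -subset0 => -[x y] xy.
  apply: (@dual_lines_not_concurrent R n n0 x n3) => i j ni nj.
  have hi : dual_line n i (x, y) by apply: xy; exists i.
  have hj : dual_line n j (x, y) by apply: xy; exists j.
  exact: etrans (esym hi) hj.
move=> _ [x ->].
pose g k := height x (angle R n (2 * k)).
suff eqg : [set p | p.1 = x] `&` \bigcup_(l in @dual_line R n @` `I_n) l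
    #= g @` `I_n.
  (* Both n - 1 and n - 2 lie in the gap between n - 3 and n. *)
  suff H m : [set p | p.1 = x] `&` \bigcup_(l in @dual_line R n @` `I_n) l
      #= `I_m -> m = n \/ (m <= n - 3)%N by split=> /H; lia.
  move=> cm; apply: (@card_heights R n n0 x) => //.
  by apply: card_eq_trans cm; rewrite card_eq_sym.
have -> : [set p | p.1 = x] `&` \bigcup_(l in @dual_line R n @` `I_n) l
    = (fun y => (x, y)) @` (g @` `I_n).
  apply/seteqP; split=> [[x' y] [/= -> [_ [k kn <-] e]]|_ [_ [k kn <-] <-]].
    by exists (g k); [exists k|congr pair; exact: esym e].
  by split => //; exists (dual_line n k) => //; exists k.
by apply: inj_card_eq => y z _ _ [].
Qed.
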